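(* Let $\mathcal{H}$ be a complex Hilbert space and let $A \in \mathcal{B}(\mathcal{H})$. Then the following are equivalent: (i) $w(A)=\frac{\|A\|}{2}$. (ii) $\|\Re(e^{\mathrm{i}\theta}A)\|=\|\Im(e^{\mathrm{i}\theta}A)\|=\frac{\|A\|}{2}$ for all $\theta\in\mathbb{R}$.
   Context: $\mathcal{B}(\mathcal{H})$ denotes the algebra of all bounded linear operators on the complex Hilbert space $\mathcal{H}$, with operator norm $\|\cdot\|$ and adjoint $A^*$. The numerical radius is $w(A)=\sup\{|\langle Ax,x\rangle| : x\in\mathcal{H},\ \|x\|=1\}$. For $T\in\mathcal{B}(\mathcal{H})$, the real and imaginary parts are the operators $\Re(T)=\frac{T+T^*}{2}$ and $\Im(T)=\frac{T-T^*}{2\mathrm{i}}$. *)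

(* Defs.v *)
From HB Require Import structures.
From mathcomp Require Import all_boot all_order all_algebra.
From mathcomp Require Import all_classical all_reals all_analysis.
From mathcomp Require Import complex.

Set Implicit Arguments.
Unset Strict Implicit.
Unset Printing Implicit Defensive.

Import Order.TTheory GRing.Theory Num.Theory.
Import numFieldNormedType.Exports.

Local Open Scope classical_set_scope.
Local Open Scope complex_scope.
Local Open Scope ring_scope.

(* The inner product is linear in its first argument and conjugate-linear in
   the second one, as {dot _ for _} prescribes. *)
HB.mixin Record NormedModule_hasInner (R : realType) H
    of NormedModule R[i] H := {
  inner : {dot H for Num.conj} ;
  inner_norm : forall x : H, inner x x = `|x| ^+ 2 }.

#[short(type="hilbertType")]
HB.structure Definition Hilbert (R : realType) :=
  {H of CompleteNormedModule R[i] H & NormedModule_hasInner R H}.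

(* Over R[i] the norm `|x| is a nonnegative element of R[i]; rnorm is the same
   number seen in R, where suprema are available. *)
Definition rnorm (R : realType) (V : normedZmodType R[i]) (x : V) : R :=
  complex.Re `|x|.

Section Operators.
Context {R : realType} {H : hilbertType R}.
Implicit Types T : H -> H.

Definition bounded_op T := [bounded T x | x in [set x | `|x| <= 1]].

Definition opnorm T : R := sup [set rnorm (T x) | x in [set x | `|x| <= 1]].

(* On the zero space the set below is empty and its sup is 0. *)
Definition numradius T : R :=
  sup [set rnorm (inner (T x) x) | x in [set x | `|x| = 1]].

(* By the Riesz representation theorem the vector selected here exists and is
   unique when T is a bounded linear operator; 0 is a junk value for other T. *)
Definition adjoint T : H -> H :=
  fun y => xget 0 [set z | forall x, inner (T x) y = inner x z].

Definition opRe T : H -> H := 2^-1 *: (T + adjoint T).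

Definition opIm T : H -> H := (2 * 'i%C)^-1 *: (T - adjoint T).

End Operators.

(* e^(i theta), by Euler's formula *)
Definition expi (R : realType) (theta : R) : R[i] := cos theta +i* sin theta.

(* Main.v *)
(* With H_t = Re(e^(it) A) one has Im(e^(it) A) = H_(t - pi/2), so (ii) says
   that |H_t| = |A| / 2 for all t.  Polarization applied to the self-adjoint
   H_t, whose quadratic form is Re(e^(it) <Ax, x>), gives |H_t| <= w(A);
   choosing t so that e^(it) <Ax, x> = |<Ax, x>| gives w(A) <= sup_t |H_t|.
   Finally e^(it) A = H_t + i H_(t - pi/2) gives |A| <= |H_t| + |H_(t - pi/2)|.
   That the adjoint exists is the Riesz representation theorem, obtained here by
   minimizing |x|^2 - 2 g(x) for a bounded real-linear functional g. *)
Require Import Defs.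
From HB Require Import structures.
From mathcomp Require Import all_boot all_order all_algebra.
From mathcomp Require Import all_classical all_reals all_analysis.
From mathcomp Require Import complex.
From mathcomp Require Import ring lra.

Set Implicit Arguments.
Unset Strict Implicit.
Unset Printing Implicit Defensive.

Import Order.TTheory GRing.Theory Num.Theory.
Import numFieldNormedType.Exports.

Local Open Scope ring_scope.

(** * The underlying real inner product and Cauchy-Schwarz *)

Section RealInner.
Context {R : realType} {H : hilbertType R}.
Implicit Types (x y z : H) (a : R[i]).

(** Being [R]-valued, it is open to order arguments and [lra], which the complex inner product is
    not. *)
Definition rin x y : R := complex.Re (inner x y).

Lemma rinDl x y z : rin (x + y) z = rin x z + rin y z.
Proof. by rewrite /rin linearDl raddfD. Qed.

Lemma innerC x y : inner x y = (inner y x)^*%C.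
Proof. by rewrite hermC expr0 mul1r. Qed.

Lemma innerZl a x y : inner (a *: x) y = a * inner x y.
Proof. by rewrite linearZl_LR. Qed.

Lemma innerZr a x y : inner x (a *: y) = a^*%C * inner x y.
Proof. by rewrite linearZr_LR. Qed.

Lemma rinC x y : rin x y = rin y x.
Proof. by rewrite /rin innerC; case: (inner y x). Qed.

Lemma rinDr x y z : rin x (y + z) = rin x y + rin x z.
Proof. by rewrite rinC rinDl !(rinC x). Qed.

Lemma rinZl (t : R) x y : rin (t%:C%C *: x) y = t * rin x y.
Proof.
by rewrite /rin innerZl; case: (inner x y) => a b; rewrite /= mul0r subr0.
Qed.

Lemma rinZr (t : R) x y : rin x (t%:C%C *: y) = t * rin x y.
Proof. by rewrite rinC rinZl rinC. Qed.

Lemma normE (V : normedZmodType R[i]) (x : V) : `|x| = (rnorm x)%:C%C.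
Proof. by rewrite /rnorm RRe_real // normr_real. Qed.

Lemma rnorm_ge0 (V : normedZmodType R[i]) (x : V) : 0 <= rnorm x.
Proof. by rewrite -ler0c -normE. Qed.

Lemma rinxx x : rin x x = rnorm x ^+ 2.
Proof. by rewrite /rin inner_norm normE -rmorphXn. Qed.

Lemma rnormZ a x : rnorm (a *: x) = rnorm a * rnorm x.
Proof. by apply: (@complexI R); rewrite -normE normrZ !normE rmorphM. Qed.

Lemma rnormN (V : normedZmodType R[i]) (x : V) : rnorm (- x) = rnorm x.
Proof. by rewrite /rnorm normrN. Qed.

Lemma rnorm0_eq0 x : rnorm x = 0 -> x = 0.
Proof. by move=> x0; apply/eqP; rewrite -normr_eq0 normE x0. Qed.

Lemma rnormC (t : R) : rnorm (t%:C%C : R[i]) = `|t|.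
Proof. by rewrite /rnorm normc_def /= expr0n addr0 sqrtr_sqr. Qed.

Lemma rinNl x y : rin (- x) y = - rin x y.
Proof. by rewrite /rin linearNl raddfN. Qed.

Lemma rinNr x y : rin x (- y) = - rin x y.
Proof. by rewrite rinC rinNl rinC. Qed.

Lemma rin0l y : rin 0 y = 0.
Proof. by rewrite /rin linear0l. Qed.

Definition rinE := (rinDl, rinDr, rinNl, rinNr, rinZl, rinZr).

Lemma rinxx_ge0 x : 0 <= rin x x.
Proof. by rewrite rinxx sqr_ge0. Qed.

(** Cauchy-Schwarz: expand the square of | |y| x - |x| y | and cancel |x| |y|, which is positive
    once the zero cases are removed. *)
Lemma rin_le x y : rin x y <= rnorm x * rnorm y.
Proof.
have [/rnorm0_eq0->|x0] := eqVneq (rnorm x) 0.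
  by rewrite rin0l mulr_ge0 ?rnorm_ge0.
have [/rnorm0_eq0->|y0] := eqVneq (rnorm y) 0.
  by rewrite rinC rin0l mulr_ge0 ?rnorm_ge0.
have xy0 : 0 < rnorm x * rnorm y.
  by rewrite mulr_gt0 // lt_neqAle eq_sym ?x0 ?y0 rnorm_ge0.
have := rinxx_ge0 ((rnorm y)%:C%C *: x - (rnorm x)%:C%C *: y).
by rewrite !rinE (rinC y x) !rinxx => h; rewrite -(ler_pM2l xy0); lra.
Qed.

(** * Riesz representation of bounded real-linear functionals *)

Section Riesz.
Variable g : H -> R.
Hypothesis gD : forall x y, g (x + y) = g x + g y.
Hypothesis gZ : forall (t : R) x, g (t%:C%C *: x) = t * g x.
Variable C : R.
Hypothesis g_le : forall x, g x <= C * rnorm x.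

(** If [z] represents [g], this is |x - z|^2 - |z|^2, so the representing vector is sought as a
    minimizer. *)
Let J x := rin x x - 2 * g x.

Let J_lb : has_lbound (range J).
Proof.
exists (- C ^+ 2) => _ [x _ <-]; rewrite /J rinxx.
have := g_le x; have := sqr_ge0 (rnorm x - C); nra.
Qed.

Let J_parallelogram x y :
  rin (x - y) (x - y) = 2 * J x + 2 * J y - 4 * J ((2^-1)%:C%C *: (x + y)).
Proof. by rewrite /J !rinE gZ gD (rinC y x); field. Qed.

(* By the parallelogram law for J, minimizing sequences are Cauchy. *)
Lemma real_riesz : exists z, forall x, g x = rin x z.
Proof.
have Jinf x : inf (range J) <= J x by apply: ge_inf => //; exists x.
have /choice [u uP] (n : nat) : exists x, J x < inf (range J) + n.+1%:R^-1.
  have [||_ [x _ <-] Jx] := @inf_adherent _ (range J) n.+1%:R^-1.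
  - by rewrite invr_gt0.
  - by split=> //; exists (J 0), 0.
  - by exists x.
have eps_cvg (e : R) : 0 < e -> (\forall n \near \oo, n.+1%:R^-1 < e)%classic.
  move=> e0; have /cvgr_dist_lt/(_ e e0) := @cvg_harmonic R.
  by apply: filterS => n; rewrite sub0r normrN /= ger0_norm.
have u_cauchy n m : rnorm (u n - u m) ^+ 2 < 2 * n.+1%:R^-1 + 2 * m.+1%:R^-1.
  rewrite -rinxx J_parallelogram; have := Jinf ((2^-1)%:C%C *: (u n + u m)).
  by move: (uP n) (uP m); move: n.+1%:R^-1 m.+1%:R^-1 => s t; lra.
have u_cvg : cvg (u n @[n --> \oo])%classic.
  apply/cauchy_cvgP/cauchy_exP => -[e e'].
  rewrite ltcE /= => /andP[/eqP -> e0].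
  (* With both reciprocals below e^2 / 4, the bound in [u_cauchy] is below e^2. *)
  have d0 : 0 < e ^+ 2 / 4 by rewrite divr_gt0 ?exprn_gt0.
  have /filter_ex [N hN] := eps_cvg _ d0.
  exists (u N); have := eps_cvg _ d0; apply: filterS => n hn.
  rewrite -ball_normE /ball_ /= normE ltcR.
  rewrite -(@ltr_pXn2r _ 2) ?nnegrE ?rnorm_ge0 ?ltW //.
  have := u_cauchy N n; move: hN hn; move: N.+1%:R^-1 n.+1%:R^-1 => s t; lra.
exists (lim (u n @[n --> \oo])%classic) => h.
set z := lim _.
(* This is J (z + k) - J z >= 0 in expanded form; the limit is taken only in [rin k (u n)], so
   continuity of [J] is not called on. *)
have J_min k : 0 <= rin k k + 2 * (rin k z - g k).
  apply/ler_addgt0Pr => e e0.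
  (* With this d, the error 1/(n+1) < d and the error 2 |z - u n| |k| <= 2 d |k| add up to at most
     e. *)
  have d0 : 0 < e / (1 + 2 * rnorm k).
    by rewrite divr_gt0 // ltr_pwDl ?mulr_ge0 ?rnorm_ge0.
  have dC0 : 0 < (e / (1 + 2 * rnorm k))%:C%C :> R[i] by rewrite ltcR.
  have /cvgr_dist_lt/(_ _ dC0) hz := u_cvg.
  have [n [+ hn]] := filter_ex (filterI hz (eps_cvg _ d0)).
  rewrite normE ltcR -/z => hz'.
  have Jn : J (u n) < J (u n + k) + n.+1%:R^-1.
    by apply: lt_le_trans (uP n) _; rewrite lerD2r.
  have uzk : rin (u n - z) k <= rnorm (z - u n) * rnorm k.
    by rewrite -(opprB z) rinNl -rinNr (le_trans (rin_le _ _)) // rnormN.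
  have : (1 + 2 * rnorm k) * (e / (1 + 2 * rnorm k)) = e.
    by rewrite mulrC divfK // gt_eqF // ltr_pwDl ?mulr_ge0 ?rnorm_ge0.
  have := ler_wpM2r (rnorm_ge0 k) (ltW hz'); move: hn Jn uzk.
  rewrite /J !rinE gD (rinC k) (rinC k).
  move: (e / _) n.+1%:R^-1 => d s; nra.
(* Test with k = t h, t = - b / (a + 1), a = |h|^2, b = <h, z> - g h. Then a t^2 + 2 t b = - (a + 2)
   t^2 must be nonnegative, so t = 0 and b = 0. The + 1 keeps the denominator positive when h =
   0. *)
have := J_min ((- (rin h z - g h) / (rin h h + 1))%:C%C *: h).
rewrite !rinE gZ -mulrBr; have := rinxx_ge0 h.
move: (rin h h) => a a0; set b := rin h z - g h; set t := _ / _ => ht.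
have a1 : 0 < a + 1 by rewrite ltr_wpDl.
have tb : t * (a + 1) = - b by rewrite divfK // gt_eqF.
have t0 : t = 0 by nra.
by apply/eqP; rewrite eq_sym -subr_eq0 -/b -oppr_eq0 -tb t0 mul0r.
Qed.
End Riesz.

End RealInner.

(** * Modulus and phase of complex numbers *)

Lemma rnormM (R : realType) (a b : R[i]%C) : rnorm (a * b) = rnorm a * rnorm b.
Proof. by apply: (@complexI R); rewrite -normE normrM !normE rmorphM. Qed.

Lemma rnormD (R : realType) (V : normedZmodType R[i]%C) (x y : V) :
  rnorm (x + y) <= rnorm x + rnorm y.
Proof. by rewrite -lecR rmorphD /= -!normE ler_normD. Qed.

Lemma Re_le_rnorm (R : realType) (z : R[i]%C) : complex.Re z <= rnorm z.
Proof.
by have := normc_ge_Re z; rewrite lecE => /andP[_ /(le_trans (ler_norm _))].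
Qed.

Lemma rnorm_expi (R : realType) (t : R) : rnorm (expi t) = 1.
Proof. by rewrite /rnorm normc_def /= cos2Dsin2 sqrtr1. Qed.

(** [acos] yields angles with nonnegative sine only, so the sign of [b] decides whether to negate
    the angle. *)
Lemma expi_acos (R : realType) (a b : R) :
  a ^+ 2 + b ^+ 2 = 1 -> exists t, expi t = (a +i* b)%C.
Proof.
move=> ab; have a1 : -1 <= a <= 1 by apply/andP; split; nra.
have sin_acos_a : sin (acos a) = `|b|.
  by rewrite sin_acos // -ab addrAC subrr add0r sqrtr_sqr.
exists (if 0 <= b then acos a else - acos a); rewrite /expi.
case: ifPn => b0; rewrite ?cosN ?sinN acosK ?in_itv // sin_acos_a.
  by rewrite ger0_norm.
by rewrite ltr0_norm ?opprK // ltNge.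
Qed.

Lemma expi_phase (R : realType) (z : R[i]%C) : exists t, expi t * z = `|z|.
Proof.
have [->|z0] := eqVneq z 0; first by exists 0; rewrite mulr0 normr0.
pose u := z^*%C / `|z|.
have : `|u| = 1 by rewrite normf_div normcJ normr_id divff ?normr_eq0.
case uE : u => [a b] u1; have [|t tE] := @expi_acos _ a b.
  apply: (@complexI R); have := add_Re2_Im2 (a +i* b)%C => /= ->.
  by rewrite u1 expr1n.
exists t; rewrite tE -uE /u mulrAC [_ * z]mulrC -sqr_normc expr2 mulfK //.
by rewrite normr_eq0.
Qed.

(** * Operator norm, adjoint and Cartesian decomposition *)

Section Operators.
Context {R : realType} {H : hilbertType R}.
Implicit Types (x y : H) (c : R[i]%C) (T : H -> H).

Lemma rnorm_inner_le x y : rnorm (inner x y) <= rnorm x * rnorm y.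
Proof.
have [t tE] := expi_phase (inner x y).
rewrite /rnorm -tE -innerZl (le_trans (rin_le _ _)) //.
by rewrite rnormZ rnorm_expi mul1r.
Qed.

(** Recovers the imaginary part from [rin], so real Riesz representation suffices for the complex
    adjoint. *)
Lemma rinZi x y : rin ('i%C *: x) y = - complex.Im (inner x y).
Proof. by rewrite /rin innerZl mulrC ReiNIm. Qed.

Lemma rin_inj x y : (forall z, rin z x = rin z y) -> x = y.
Proof.
move=> xy; apply/eqP; rewrite -subr_eq0; apply/eqP/rnorm0_eq0/eqP.
by rewrite -sqrf_eq0 -rinxx rinDr rinNr xy subrr.
Qed.

Lemma adjoint_eq T y z :
  (forall x, inner (T x) y = inner x z) -> adjoint T y = z.
Proof.
move=> zP; apply: xget_unique => // z' /= z'P.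
by apply: rin_inj => x; rewrite /rin -z'P zP.
Qed.

Lemma opnorm_le T (M : R) :
  (forall x, rnorm x <= 1 -> rnorm (T x) <= M) -> opnorm T <= M.
Proof.
move=> TM; apply: ge_sup => [|_ [x /= x1 <-]].
  by exists (rnorm (T 0)), 0; rewrite //= normr0.
by apply: TM; rewrite -lecR -normE.
Qed.

(** Stated for any map, since [opRe] is not packaged as linear; the bound [M] ensures that the
    supremum is a genuine one. *)
Lemma le_opnorm T (M : R) x :
  (forall x, rnorm x <= 1 -> rnorm (T x) <= M) -> rnorm x <= 1 ->
  rnorm (T x) <= opnorm T.
Proof.
move=> TM x1; apply: ub_le_sup; last by exists x; rewrite //= normE lecR.
by exists M => _ [z /= z1 <-]; apply: TM; rewrite -lecR -normE.
Qed.

Variables (A : {linear H -> H}) (A_bounded : bounded_op A).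

Lemma bounded_opP : exists M : R, forall x, rnorm x <= 1 -> rnorm (A x) <= M.
Proof.
(* Boundedness gives a bound for each number strictly above [M]; [M + 1] is one. *)
have [M [Mr /(_ (M + 1))]] := A_bounded.
rewrite ltrDl ltr01 => /(_ isT) AM.
exists (complex.Re (M + 1)) => x x1.
have /AM : [set x : H | `|x| <= 1]%classic x by rewrite /= normE lecR.
by rewrite /= lecE => /andP[].
Qed.

Lemma rnorm_le_opnorm x : rnorm x <= 1 -> rnorm (A x) <= opnorm A.
Proof. by have [M MP] := bounded_opP; apply: le_opnorm MP. Qed.

Lemma opnorm_ge0 : 0 <= opnorm A.
Proof.
apply: le_trans (@rnorm_le_opnorm 0 _); first exact: rnorm_ge0.
by rewrite /rnorm normr0 ler01.
Qed.

Lemma rnorm_normalize x : rnorm x != 0 -> rnorm ((rnorm x)^-1%:C%C *: x) = 1.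
Proof.
by move=> x0; rewrite rnormZ rnormC ger0_norm ?invr_ge0 ?rnorm_ge0 // mulVf.
Qed.

Lemma rnorm_le_opnormM x : rnorm (A x) <= opnorm A * rnorm x.
Proof.
have [/rnorm0_eq0->|x0] := eqVneq (rnorm x) 0.
  by rewrite linear0 /rnorm normr0 mulr0.
have := @rnorm_le_opnorm ((rnorm x)^-1%:C%C *: x).
rewrite rnorm_normalize // linearZ rnormZ rnormC ger0_norm;
  last by rewrite invr_ge0 rnorm_ge0.
by rewrite ler_pdivrMl ?lt_neqAle 1?eq_sym ?x0 ?rnorm_ge0 // mulrC; apply.
Qed.

(** Riesz applied to x |-> Re <A x, y> matches the real parts; replacing x by i x matches the
    imaginary parts. *)
Lemma adjointP x y : inner (A x) y = inner x (adjoint A y).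
Proof.
have [||x'|z zP] :=
  @real_riesz _ _ (fun x => rin (A x) y) _ _ (opnorm A * rnorm y).
- by move=> u v; rewrite linearD rinDl.
- by move=> t u; rewrite linearZ rinZl.
- rewrite (le_trans (rin_le _ _)) // mulrAC.
  by rewrite ler_wpM2r ?rnorm_ge0 ?rnorm_le_opnormM.
suff zE u : inner (A u) y = inner u z by rewrite (adjoint_eq zE) zE.
apply/eqP; rewrite eq_complex; apply/andP; split; apply/eqP; first exact: zP.
by apply: oppr_inj; rewrite -!rinZi -zP linearZ.
Qed.

Lemma adjointZ c y : adjoint (c *: (A : H -> H)) y = c^*%C *: adjoint A y.
Proof.
by apply: adjoint_eq => x; rewrite innerZl innerZr conjcK adjointP.
Qed.

Lemma opReE c x :
  opRe (c *: (A : H -> H)) x = 2^-1 *: (c *: A x + c^*%C *: adjoint A x).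
Proof. by rewrite -adjointZ. Qed.

Lemma opImE c x :
  opIm (c *: (A : H -> H)) x =
    (2 * 'i%C)^-1 *: (c *: A x - c^*%C *: adjoint A x).
Proof. by rewrite -adjointZ. Qed.

Lemma complexi_neq0 : 'i%C != 0 :> R[i]%C.
Proof. by rewrite eq_complex /= oner_eq0 andbF. Qed.

(** Since 1/i = -i and the conjugate of -i c is i times that of c, both sides have the same
    coefficients on [A] and its adjoint. *)
Lemma opIm_opRe c :
  opIm (c *: (A : H -> H)) = opRe ((- 'i%C * c) *: (A : H -> H)).
Proof.
apply/funext => x; rewrite opReE opImE.
rewrite !scalerDr scalerN -scaleNr !scalerA.
have iV : ('i%C : R[i]%C)^-1 = - 'i%C.
  apply: (mulfI complexi_neq0); rewrite divff ?complexi_neq0 //.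
  by rewrite mulrN -expr2 sqr_i opprK.
rewrite invfM iV rmorphM /= (_ : (- 0 -i* - 1)%C = 'i%C :> R[i]%C).
  by congr (_ *: _ + _ *: _); ring.
by apply/eqP; rewrite eq_complex /= oppr0 opprK !eqxx.
Qed.

Lemma cartesian c x :
  c *: A x = opRe (c *: (A : H -> H)) x + 'i%C *: opIm (c *: (A : H -> H)) x.
Proof.
rewrite opReE opImE scalerA invfM mulrCA divff ?complexi_neq0 //.
rewrite mulr1 -scalerDr.
by rewrite addrACA subrr addr0 scalerDr -scalerDl -[2^-1]mul1r -splitr scale1r.
Qed.

(** For y = x it identifies the quadratic form of the real part as Re (c <A x, x>); its symmetry in
    x and y enables polarization. *)
Lemma rin_opRe c x y :
  2 * rin (opRe (c *: (A : H -> H)) x) y = rin (c *: A x) y + rin (c *: A y) x.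
Proof.
rewrite opReE (_ : 2^-1 = (2^-1)%:C%C); last by rewrite fmorphV rmorph_nat.
rewrite rinZl mulVKf // rinDl; congr (_ + _).
by rewrite [LHS]rinC /rin innerZr innerZl conjcK adjointP.
Qed.

(** * Numerical radius against the norms of rotated real parts *)

Lemma rnorm_inner_le_numradius x :
  rnorm x = 1 -> rnorm (inner (A x) x) <= numradius A.
Proof.
move=> x1; apply: ub_le_sup; last by exists x; rewrite //= normE x1.
exists (opnorm A) => _ [z /= z1 <-].
have {}z1 : rnorm z = 1 by rewrite /rnorm z1.
by rewrite (le_trans (rnorm_inner_le _ _)) // z1 mulr1 rnorm_le_opnorm ?z1.
Qed.

Lemma numradius_no_unit : ~ (exists x : H, rnorm x = 1) -> numradius A = 0.
Proof.
move=> no_x; rewrite /numradius (_ : [set x | `|x| = 1] = set0)%classic.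
  by rewrite image_set0 sup0.
by rewrite -subset0 => x /= x1; apply: no_x; exists x; rewrite /rnorm x1.
Qed.

Lemma numradius_ge0 : 0 <= numradius A.
Proof.
have [[x x1]|no_x] := pselect (exists x : H, rnorm x = 1).
  exact: le_trans (rnorm_ge0 _) (rnorm_inner_le_numradius x1).
by rewrite numradius_no_unit.
Qed.

(** The condition 0 <= M covers the space without unit vectors, where the radius is 0 by default. *)
Lemma numradius_le (M : R) : 0 <= M ->
  (forall x, rnorm x = 1 -> rnorm (inner (A x) x) <= M) -> numradius A <= M.
Proof.
move=> M0 AM; have [[x x1]|no_x] := pselect (exists x : H, rnorm x = 1).
  apply: ge_sup => [|_ [z /= z1 <-]]; last by apply: AM; rewrite /rnorm z1.
  by exists (rnorm (inner (A x) x)), x; rewrite //= normE x1.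
by rewrite numradius_no_unit.
Qed.

Lemma rnorm_inner_le_numradiusM x :
  rnorm (inner (A x) x) <= numradius A * rnorm x ^+ 2.
Proof.
have [/rnorm0_eq0->|x0] := eqVneq (rnorm x) 0.
  by rewrite linear0r /rnorm !normr0 expr0n mulr0.
have := rnorm_inner_le_numradius (rnorm_normalize x0).
set s := (rnorm x)^-1.
have s0 : 0 < s by rewrite invr_gt0 lt_neqAle eq_sym x0 rnorm_ge0.
rewrite [A _]linearZ innerZl innerZr conjc_real !rnormM rnormC gtr0_norm //.
have sx : s * rnorm x = 1 by rewrite mulVf.
move: s0 sx; move: (rnorm (inner _ _)) (numradius A) (rnorm x) => q w n.
move=> s0 sx sq.
have -> : q = (s * n) ^+ 2 * q by rewrite sx expr1n mul1r.
by rewrite exprMn; nra.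
Qed.

Lemma rin_le_numradiusM c x :
  rnorm c = 1 -> rin (c *: A x) x <= numradius A * rnorm x ^+ 2.
Proof.
move=> c1; apply: le_trans (rnorm_inner_le_numradiusM x).
rewrite /rin innerZl (le_trans (Re_le_rnorm _)) //.
by rewrite rnormM c1 mul1r.
Qed.

(** Take y = Sx / |Sx| and q(v) = Re <c A v, v>. Then 4 |Sx| = q(x + y) - q(x - y) <= w (|x + y|^2 +
    |x - y|^2) = 2 w (|x|^2 + |y|^2) <= 4 w. *)
Lemma rnorm_opRe_le c x : rnorm c = 1 -> rnorm x <= 1 ->
  rnorm (opRe (c *: (A : H -> H)) x) <= numradius A.
Proof.
move=> c1 x1; set Sx := opRe _ x.
have [->|Sx0] := eqVneq (rnorm Sx) 0; first exact: numradius_ge0.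
have [y y1 Sxy] : exists2 y, rnorm y = 1 & rin Sx y = rnorm Sx.
  exists ((rnorm Sx)^-1%:C%C *: Sx); first exact: rnorm_normalize.
  by rewrite rinZr rinxx expr2 mulKf.
have := rin_opRe c x y; rewrite -/Sx Sxy.
have := rin_le_numradiusM (x + y) c1.
(* The coefficient -c bounds q(x - y) from below. *)
have := @rin_le_numradiusM (- c) (x - y); rewrite {1}/rnorm normrN => /(_ c1).
rewrite scaleNr [A (x + y)]linearD [A (x - y)]linearB.
rewrite !scalerDr scalerN -!rinxx !rinE.
rewrite (rinC y x) !rinxx y1 expr1n.
have : rnorm x ^+ 2 <= 1 by rewrite expr_le1 ?rnorm_ge0.
by move/(ler_wpM2l numradius_ge0); lra.
Qed.

Lemma opnorm_opRe_le c : rnorm c = 1 ->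
  opnorm (opRe (c *: (A : H -> H))) <= numradius A.
Proof. by move=> c1; apply: opnorm_le => x; apply: rnorm_opRe_le. Qed.

Lemma rnorm_opRe_le_opnorm c x : rnorm c = 1 -> rnorm x <= 1 ->
  rnorm (opRe (c *: (A : H -> H)) x) <= opnorm (opRe (c *: (A : H -> H))).
Proof.
by move=> c1; apply: (@le_opnorm _ (numradius A)) => z; apply: rnorm_opRe_le.
Qed.

Lemma numradius_le_opRe (M : R) : 0 <= M ->
  (forall t, opnorm (opRe (expi t *: (A : H -> H))) <= M) -> numradius A <= M.
Proof.
move=> M0 AM; apply: numradius_le => // x x1.
have [t tE] := expi_phase (inner (A x) x).
rewrite /rnorm -tE -innerZl -/(rin _ x).
have -> : rin (expi t *: A x) x = rin (opRe (expi t *: (A : H -> H)) x) x.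
  by have := rin_opRe (expi t) x x; lra.
rewrite (le_trans (rin_le _ _)) // x1 mulr1 (le_trans _ (AM t)) //.
by rewrite rnorm_opRe_le_opnorm ?rnorm_expi ?x1.
Qed.

End Operators.

(** * Quarter-turn rotation and the equivalence *)

Lemma mulNi_expi (R : realType) (t : R) : - 'i%C * expi t = expi (t - pi / 2).
Proof.
apply/eqP; rewrite eq_complex /= cosB sinB cos_pihalf sin_pihalf.
by apply/andP; split; apply/eqP; ring.
Qed.

Theorem theorem2p4 (R : realType) (H : hilbertType R) (A : {linear H -> H})
    (A_bounded : bounded_op A) :
  numradius A = opnorm A / 2 <->
  (forall theta : R,
     opnorm (opRe (expi theta *: (A : H -> H))) =
       opnorm (opIm (expi theta *: (A : H -> H))) /\
     opnorm (opIm (expi theta *: (A : H -> H))) = opnorm A / 2).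
Proof.
have opRe_le t := opnorm_opRe_le A_bounded (rnorm_expi t).
have opIm_expi t : opIm (expi t *: (A : H -> H)) =
    opRe (expi (t - pi / 2) *: (A : H -> H)).
  by rewrite opIm_opRe // mulNi_expi.
split=> [wA t|ReIm].
  (* Both summands are at most w(A) = |A| / 2, so a sum of at least |A| forces equality in each. *)
  suff : opnorm A <= opnorm (opRe (expi t *: (A : H -> H))) +
                     opnorm (opIm (expi t *: (A : H -> H))).
    by rewrite opIm_expi; have := opRe_le t; have := opRe_le (t - pi / 2); lra.
  apply: opnorm_le => x x1.
  rewrite -[rnorm _]mul1r -(rnorm_expi t) -rnormZ (cartesian A_bounded).
  apply: le_trans (rnormD _ _) _; rewrite lerD //.
    by rewrite rnorm_opRe_le_opnorm ?rnorm_expi.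
  rewrite rnormZ opIm_expi (_ : rnorm 'i%C = 1) ?mul1r.
    by rewrite rnorm_opRe_le_opnorm ?rnorm_expi.
  by rewrite /rnorm normc_def /= expr0n expr1n add0r sqrtr1.
have Re_eq t : opnorm (opRe (expi t *: (A : H -> H))) = opnorm A / 2.
  by have [-> ->] := ReIm t.
apply/eqP; rewrite eq_le; apply/andP; split.
  apply: numradius_le_opRe => // [|t]; last by rewrite Re_eq.
  by rewrite divr_ge0 ?opnorm_ge0.
(* For the lower bound on w(A) a single angle is enough. *)
by rewrite -(Re_eq 0).
Qed.
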